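(* Fix constants $\alpha>0$ and $\beta\ge1/6$, and run the algorithm SELECT described in the context with $f(n):=n^{2/3}\ln^{1/3}n$, $s(n):=\min\{\lceil\alpha f(n)\rceil,n-1\}$ and $g(n):=(\beta s(n)\ln n)^{1/2}$. There exists a constant $\gamma>0$ such that the following holds. For every $n\ge1$, every $k$ with $1\le k\le n$, and every input list $X$ of size $n$, the expected number $C_{nk}$ of comparisons made by SELECT$(X,k)$ satisfies $$C_{nk}\le n+\min\{k,n-k\}+\gamma f(n).$$
   Context: Algorithm SELECT$(X,k)$. The input is a list $X$ of $n$ elements of a totally ordered set (repeated values allowed) and an integer $1\le k\le n$. It returns the $k$th smallest element, i.e. the $k$th entry of $X$ sorted nondecreasingly. The sample size $s=s(n)$ and gap $g=g(n)>0$ are given functions with $1\le s(n)\le n-1$ for $n\ge2$. 1. If $n=1$, return the single element. Otherwise set $s:=s(n)$ and $g:=g(n)$. 2. Choose a set of $s$ positions of $X$ uniformly at random among all $s$-subsets, independently of all other random choices. Let $S$ be the sub-list at those positions. 3. Set $i_u:=\max\{\lceil ks/n-g\rceil,1\}$ and $i_v:=\min\{\lceil ks/n+g\rceil,s\}$. Find $u$, the $i_u$th smallest element of $S$, by the recursive call SELECT$(S,i_u)$. If $i_v>i_u$, find $v$ as the $(i_v-i_u)$th smallest element of the sub-list of $S$ formed by its $s-i_u$ largest elements, by a recursive call of SELECT; if $i_v=i_u$, set $v:=u$. - It is assumed that each call of SELECT identifies, without extra comparisons, which elements form the $k$ smallest. - It is assumed that after Step 3 the relation ($<$, $=$, $>$)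 of every sample element to $u$ and to $v$ is known without further comparisons. 4. Each element $x$ of $X$ not in the sample is compared with the pivots. - If $k<n/2$: $x$ is compared with $v$ first, and with $u$ only if $x<v$ and $u<v$. - If $k\ge n/2$: $x$ is compared with $u$ first, and with $v$ only if $x>u$ and $u<v$. This yields the partition of $X$ into $L=\{x<u\}$, $U=\{x=u\}$, $M=\{u<x<v\}$, $V=\{x=v\}$ and $R=\{x>v\}$. 5. If $|L|<k\le|L\cup U|$, return $u$. If $|L\cup U\cup M|<k\le n-|R|$, return $v$. 6. If $k\le|L|$, set $\hat X:=L$ and $\hat k:=k$. Else if $n-|R|<k$, set $\hat X:=R$ and $\hat k:=k-n+|R|$. Else set $\hat X:=M$ and $\hat k:=k-|L\cup U|$. 7. Return SELECT$(\hat X,\hat k)$. The comparisons counted are those made in Step 4 together with all comparisons made in the recursive calls of Steps 3 and 7. The expectation is over all random sample choices. *)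

(* Defs.v *)
From HB Require Import structures.
From mathcomp Require Import all_boot all_order all_algebra.
From mathcomp Require Import all_classical all_reals all_analysis.
Set Implicit Arguments. Unset Strict Implicit. Unset Printing Implicit Defensive.
Import Order.TTheory GRing.Theory Num.Theory.
Local Open Scope ring_scope.

Section Select.
Variable R : realType.
Variables (alpha beta : R).

Definition fsel (n : nat) : R := (n%:R `^ (2/3)) * ((ln n%:R) `^ (1/3)).

(* s(n) = min { ceil (alpha f(n)), n - 1 }  (alpha f(n) >= 0, so the ceiling is >= 0) *)
Definition ssel (n : nat) : nat := minn `|Num.ceil (alpha * fsel n)|%N n.-1.

Definition gsel (n : nat) : R := Num.sqrt (beta * (ssel n)%:R * ln n%:R).

Definition iu_sel (n k : nat) : nat :=
  `|Num.max (Num.ceil (k%:R * (ssel n)%:R / n%:R - gsel n)) 1|%N.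

Definition iv_sel (n k : nat) : nat :=
  `|Num.min (Num.ceil (k%:R * (ssel n)%:R / n%:R + gsel n)) (ssel n)%:Z|%N.

Variable (disp : Order.disp_t) (T : orderType disp).

(* Expected number of comparisons of SELECT(X,k).  [fuel] only serves to make the
   recursion structural: every recursive call is on a list strictly shorter than X,
   so with initial fuel = size X the case [fuel = 0] is never reached on a
   nonempty list.  The expectation over the uniformly random s-subset of positions
   chosen at the top level is the average over all such subsets; the recursive
   calls use independent randomness, so (by linearity) their contribution is their
   own expected cost. *)
Fixpoint sel_cost (fuel : nat) (X : seq T) (k : nat) {struct fuel} : R :=
  match fuel, X with
  | 0, _ => 0
  | _, [::] => 0
  | fuel'.+1, x0 :: _ =>
    let n := size X in
    if n == 1%N then 0 else
    let s := ssel n in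
    let iu := iu_sel n k in
    let iv := iv_sel n k in
    (\sum_(S : {set 'I_n} | #|S| == s)
       let smp := [seq nth x0 X (val i) | i <- enum S] in
       let srt := sort <=%O smp in
       let u := nth x0 srt iu.-1 in
       let v := nth x0 srt iv.-1 in
       let c_u := sel_cost fuel' smp iu in
       let c_v := if (iu < iv)%N then sel_cost fuel' (drop iu srt) (iv - iu) else 0 in
       (* Step 4: comparisons of non-sample elements with the pivots *)
       let rest := [seq nth x0 X (val i) | i <- enum (~: S)] in
       let c4 := (\sum_(x <- rest)
                    (if (2 * k < n)%N
                     then 1 + ((x < v)%O && (u < v)%O)
                     else 1 + ((u < x)%O && (u < v)%O)))%N in
       let cL := count (fun x => (x < u)%O) X in
       let cLU := count (fun x => (x <= u)%O) X in
       let cLUM := count (fun x => (x <= u)%O || ((u < x)%O && (x < v)%O)) X in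
       let cR := count (fun x => (v < x)%O) X in
       let c7 :=
         if (cL < k <= cLU)%N then 0
         else if (cLUM < k <= n - cR)%N then 0
         else if (k <= cL)%N then sel_cost fuel' (seq.filter (fun x => (x < u)%O) X) k
         else if (n - cR < k)%N then
           sel_cost fuel' (seq.filter (fun x => (v < x)%O) X) (k - (n - cR))
         else sel_cost fuel' (seq.filter (fun x => (u < x)%O && (x < v)%O) X) (k - cLU) in
       c4%:R + c_u + c_v + c7)
    / #|[set S : {set 'I_n} | #|S| == s]|%:R
  end.

Definition select_cost (X : seq T) (k : nat) : R := sel_cost (size X) X k.

End Select.

(* Main.v *)
Require Import Defs.
From HB Require Import structures.
From mathcomp Require Import all_boot all_order all_algebra.
From mathcomp Require Import all_classical all_reals all_analysis.
From mathcomp Require Import ring lra zify.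
Import Order.TTheory GRing.Theory Num.Theory.
Local Open Scope ring_scope.
Set Implicit Arguments.
Unset Strict Implicit.
Unset Printing Implicit Defensive.

(** Let s = s(n), g = g(n), q = g n / s.  If A is the set of positions of the j
smallest elements of X, then |S /\ A| is hypergeometric, and Hoeffding's bound
makes a deviation of g from its mean j s / n have probability at most
exp (- 2 g^2 / s) = n^(- 2 beta) <= n^(- 1/3).  Applying this with j about
k + 2 q, k - 2 q, k and k - 1 shows that, outside an event of probability
4 n^(- 1/3), at most k + 2 q + 1 elements are below v, at most n - k + 2 q + 1
are above u, and the list of Step 7 has at most 4 q + 2 elements.  Step 4 then
costs n + min (k, n - k) + O(q), the exceptional event contributes
O(n^(2/3)), and q and s are O(f(n)).  Since s and 4 q + 2 are o(n), the
recursive terms gamma f(s) and gamma f(4 q + 2) are small fractions of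
gamma f(n), and the induction closes for large n; the finitely many remaining
n are absorbed in gamma. *)

(** * Sampling without replacement *)

(** Group the subsets of [B] by cardinality. The range of [j] depends on [T] only, so sums for
    different [B] can be added termwise. *)
Lemma sum_subsets_card (R : nmodType) (T : finType) (B : {set T}) (F : nat -> R) :
  \sum_(J : {set T} | J \subset B) F #|J|
    = \sum_(j < #|T|.+1) F j *+ 'C(#|B|, j).
Proof.
rewrite (partition_big (fun J : {set T} => inord #|J| : 'I_#|T|.+1) xpredT) //=.
apply: eq_bigr => j _; rewrite -cards_draws -sumr_const.
have cardE (J : {set T}) : (inord #|J| == j) = (#|J| == j).
  by rewrite -val_eqE /= inordK // ltnS max_card.
rewrite (eq_bigl (fun J : {set T} => J \in [set A : {set T} | A \subset B & #|A| == j])).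
  by apply: eq_bigr => J; rewrite inE => /andP[_ /eqP->].
by move=> J; rewrite inE cardE.
Qed.

Lemma expr1D_wide (R : comPzRingType) (y : R) (m N : nat) :
  (m <= N)%N -> (1 + y) ^+ m = \sum_(j < N.+1) y ^+ j *+ 'C(m, j).
Proof.
move=> le_mN; rewrite exprDn.
under eq_bigr => i _ do rewrite expr1n mul1r.
rewrite (big_ord_widen N.+1 (fun i => y ^+ i *+ 'C(m, i))) // [LHS]big_mkcond /=.
apply: eq_bigr => i _; case: ifP => // /negbT.
by rewrite -leqNgt => lt_mi; rewrite bin_small // mulr0n.
Qed.

(** Complementation sends these supersets to the subsets of [~: J] with [#|T| - s] elements. In this
    form the binomial is 0, as it should be, when [s < #|J|]. *)
Lemma card_supersets (T : finType) (J : {set T}) (s : nat) :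
  (s <= #|T|)%N ->
  #|[set S : {set T} | J \subset S & #|S| == s]| = 'C(#|T| - #|J|, #|T| - s).
Proof.
move=> le_sT; have -> : (#|T| - #|J|)%N = #|~: J| by rewrite [RHS]cardsCs finset.setCK.
rewrite -cards_draws -(card_imset _ (@finset.setC_inj T)).
apply: eq_card => S; rewrite !inE; apply/imsetP/andP => [[U]|[sSJ /eqP cS]].
  rewrite inE => /andP[sJU /eqP cU] ->; rewrite finset.setCS sJU; split=> //.
  by rewrite [#|~: U|]cardsCs finset.setCK cU.
exists (~: S); last by rewrite finset.setCK.
by rewrite inE -finset.setCS finset.setCK sSJ cardsCs finset.setCK cS subKn ?eqxx.
Qed.

(** Expand each power as a sum of [y ^+ #|J|] over [J] inside [S :&: A], exchange the sums, and
    count the samples containing a given [J]. *)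
Lemma sum_exp_sample (R : comPzRingType) (T : finType) (A : {set T}) (s : nat) (y : R) :
  (s <= #|T|)%N ->
  \sum_(S : {set T} | #|S| == s) (1 + y) ^+ #|S :&: A|
    = \sum_(j < #|T|.+1) y ^+ j *+ ('C(#|A|, j) * 'C(#|T| - j, #|T| - s)).
Proof.
move=> le_sT.
under eq_bigr => S _ do rewrite (expr1D_wide y (max_card (mem (S :&: A))))
  -(sum_subsets_card (S :&: A) (fun j => y ^+ j)).
rewrite (exchange_big_dep (fun J : {set T} => J \subset A)) /=; last first.
  by move=> S J _; rewrite finset.subsetI => /andP[].
under eq_bigr => J sJA.
  rewrite sumr_const.
  rewrite (eq_card (B := [set S : {set T} | J \subset S & #|S| == s])); last first.
    by move=> S; rewrite !inE unfold_in finset.subsetI sJA andbT andbC.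
  rewrite card_supersets //.
  over.
rewrite (sum_subsets_card A (fun j => y ^+ j *+ 'C(#|T| - j, #|T| - s))).
by apply: eq_bigr => j _; rewrite -mulrnA mulnC.
Qed.

(** Factor by factor, (a - i) / (n - i) <= a / n, with denominators cleared. *)
Lemma ffact_expn_le (a n j : nat) : (a <= n)%N -> (a ^_ j * n ^ j <= n ^_ j * a ^ j)%N.
Proof.
move=> le_an; elim: j => // j IHj; rewrite !ffactnSr !expnSr mulnACA [leqRHS]mulnACA.
apply: leq_mul => //; rewrite !mulnBl (mulnC n a) leq_sub2l // leq_mul2l le_an.
by rewrite orbT.
Qed.

Lemma bin_expn_le (a n j : nat) : (a <= n)%N -> ('C(a, j) * n ^ j <= 'C(n, j) * a ^ j)%N.
Proof.
move=> /(ffact_expn_le j); rewrite -!bin_ffact.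
by rewrite mulnAC [leqRHS]mulnAC leq_pmul2r // fact_gt0.
Qed.

(** For [j <= s], both sides become n! after multiplication by j! (s-j)! (n-s)!; for [j > s] both
    vanish. *)
Lemma bin_trinomial (n s j : nat) :
  (s <= n)%N -> ('C(n, s) * 'C(s, j) = 'C(n, j) * 'C(n - j, n - s))%N.
Proof.
move=> le_sn; have [le_js|lt_sj] := leqP j s; last first.
  rewrite (bin_small lt_sj) muln0; case: (leqP j n) => [le_jn|lt_jn].
    by rewrite [X in (_ * X)%N]bin_small ?muln0 // ltn_sub2l // (leq_trans lt_sj).
  by rewrite (bin_small lt_jn).
have f0 : (0 < j`! * (s - j)`! * (n - s)`!)%N by rewrite !muln_gt0 !fact_gt0.
apply/eqP; rewrite -(eqn_pmul2r f0); apply/eqP.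
have e1 := bin_fact le_sn; have e2 := bin_fact le_js.
have e3 := bin_fact (leq_trans le_js le_sn).
have /bin_fact : (n - s <= n - j)%N by rewrite leq_sub2l.
have -> : (n - j - (n - s) = s - j)%N by lia.
move=> e4; transitivity n`!; first by rewrite -e1 -e2; ring.
by rewrite -e3 -e4; ring.
Qed.

(* Expanding in powers of [y] turns both sides into factorial moments; those of the
   hypergeometric law are dominated by the binomial ones since
   a (a-1) ... (a-j+1) / (n (n-1) ... (n-j+1)) <= (a / n)^j. *)
Lemma sample_mgf_le (R : numFieldType) (T : finType) (A : {set T}) (s : nat) (y : R) :
  (s <= #|T|)%N -> (0 < #|T|)%N -> 0 <= y ->
  \sum_(S : {set T} | #|S| == s) (1 + y) ^+ #|S :&: A|
    <= 'C(#|T|, s)%:R * (1 + y * (#|A|%:R / #|T|%:R)) ^+ s.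
Proof.
move=> le_sT T0 y0; rewrite sum_exp_sample // (expr1D_wide _ le_sT) mulr_sumr.
apply: ler_sum => j _; set n := #|T|; set a := #|A|.
have le_an : (a <= n)%N by exact: max_card.
have n0 : 0 < n%:R ^+ j :> R by rewrite exprn_gt0 // ltr0n.
have -> : y ^+ j *+ ('C(a, j) * 'C(n - j, n - s)) =
    y ^+ j * (('C(a, j) * n ^ j * 'C(n - j, n - s))%:R / n%:R ^+ j).
  rewrite mulnAC [in RHS]natrM natrX -mulr_natr mulfK //; exact: lt0r_neq0.
have -> : 'C(n, s)%:R * ((y * (a%:R / n%:R)) ^+ j *+ 'C(s, j)) =
    y ^+ j * (('C(n, s) * 'C(s, j) * a ^ j)%:R / n%:R ^+ j).
  rewrite -mulr_natr !exprMn exprVn !natrM natrX; ring.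
apply: ler_wpM2l; first exact: exprn_ge0.
rewrite ler_pM2r ?invr_gt0 // ler_nat bin_trinomial // [leqRHS]mulnAC leq_mul2r.
by rewrite bin_expn_le // orbT.
Qed.

(** * Hoeffding's inequality *)

Lemma is_derive_ge0_le0 (R : realType) (f df : R -> R) :
  (forall x : R, is_derive x 1 f (df x)) -> (forall x, 0 <= x -> 0 <= df x) ->
  forall l, 0 <= l -> f 0 <= f l.
Proof.
move=> fdf df_ge0 l l0; apply: (@ger0_derive1_ndecry _ f 0) => // [x|].
- rewrite in_itv /= andbT => x0; rewrite derive1E.
  by case: (fdf x) => _ ->; rewrite df_ge0 // ltW.
- by apply: derivable_within_continuous => x _; case: (fdf x).
Qed.

Lemma bernoulli_mgf_gt0 (R : realType) (p x : R) : 0 <= p <= 1 ->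
  0 < 1 - p + p * expR x.
Proof.
move=> /andP[p0 p1]; move: p0; rewrite le_eqVlt => /orP[/eqP <-|p0].
  by rewrite mul0r; lra.
by rewrite ltr_wpDl ?subr_ge0 // mulr_gt0 // expR_gt0.
Qed.

(* The log-moment generating function of a Bernoulli variable has derivative
   q = p e^l / (1 - p + p e^l), and q' = q (1 - q) <= 1/4. *)
Lemma hoeffding_tilt (R : realType) (p l : R) : 0 <= p <= 1 -> 0 <= l ->
  p * expR l / (1 - p + p * expR l) <= p + l / 4.
Proof.
move=> p01 l0; have D0 x := bernoulli_mgf_gt0 x p01.
pose f (x : R) := p + x / 4 - p * expR x / (1 - p + p * expR x).
pose df (x : R) := 1 / 4 - p * expR x * (1 - p) / (1 - p + p * expR x) ^+ 2.
suff : f 0 <= f l.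
  rewrite /f expR0 !mulr1 subrK divr1 mul0r addr0 subrr; lra.
apply: (@is_derive_ge0_le0 _ f df _ _ l l0) => x; last first.
  move=> _; rewrite /df subr_ge0 ler_pdivrMr ?exprn_gt0 //.
  (* With a = 1 - p and b = p e^x, this is a b <= (a + b)^2 / 4. *)
  rewrite -subr_ge0 (_ : _ - _ = ((1 - p - p * expR x) / 2) ^+ 2) ?sqr_ge0 //.
  by field.
have Dx : is_derive x 1 (fun x : R => 1 - p + p * expR x) (p * expR x).
  apply: is_derive_eq; rewrite /GRing.scale /=; ring.
have Vx := @is_deriveV _ _ x _ (1 : R) (lt0r_neq0 (D0 x)) Dx.
rewrite /f /df; apply: is_derive_eq.
rewrite /GRing.scale /=; field; exact: lt0r_neq0.
Qed.

(** The ratio of the two sides is 1 at [l = 0], and [hoeffding_tilt] makes its derivative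
    nonpositive. The auxiliary [f] is minus this ratio. *)
Lemma hoeffding_bernoulli_mgf (R : realType) (p l : R) : 0 <= p <= 1 -> 0 <= l ->
  1 - p + p * expR l <= expR (p * l + l ^+ 2 / 8).
Proof.
move=> p01 l0.
pose f (x : R) := - ((1 - p + p * expR x) * expR (- (p * x + x ^+ 2 / 8))).
pose df (x : R) := expR (- (p * x + x ^+ 2 / 8)) *
  ((1 - p + p * expR x) * (p + x / 4) - p * expR x).
suff : f 0 <= f l.
  rewrite /f expR0 mulr1 subrK expr0n mul0r mulr0 addr0 oppr0 expR0 mulr1.
  by rewrite lerN2 expRN ler_pdivrMr ?expR_gt0 // mul1r.
apply: (@is_derive_ge0_le0 _ f df _ _ l l0) => x; last first.
  move=> x0; rewrite /df mulr_ge0 ?expR_ge0 // subr_ge0.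
  have D0 := bernoulli_mgf_gt0 x p01.
  by have := hoeffding_tilt p01 x0; rewrite ler_pdivrMr // [leRHS]mulrC.
have Ex : is_derive x 1 (fun x : R => expR (- (p * x + x ^+ 2 / 8)))
    (expR (- (p * x + x ^+ 2 / 8)) * - (p + x / 4)).
  have Gx : is_derive x 1 (fun x : R => - (p * x + x ^+ 2 / 8)) (- (p + x / 4)).
    apply: is_derive_eq; rewrite /GRing.scale /=.
    by field.
  exact: (is_derive1_comp (is_derive_expR _) Gx).
rewrite /f /df; apply: is_derive_eq; rewrite /GRing.scale /=; ring.
Qed.

(** Chernoff's method: the indicator of the event is at most e^(l (|S /\ A| - s p - t)), and
    [sample_mgf_le] with y = e^l - 1 reduces the sum to [s] Bernoulli factors. *)
Lemma sample_upper_tail (R : realType) (T : finType) (A : {set T}) (s : nat) (t : R) :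
  (0 < s <= #|T|)%N -> 0 <= t ->
  #|[set S : {set T} | (#|S| == s) &&
       (s%:R * (#|A|%:R / #|T|%:R) + t <= #|S :&: A|%:R)]|%:R
    <= 'C(#|T|, s)%:R * expR (- 2 * t ^+ 2 / s%:R).
Proof.
move=> /andP[s0 le_sT] t0; set n := #|T|; set p : R := _ / _.
have n0 : (0 < n)%N by exact: leq_trans le_sT.
have s0' : 0 < s%:R :> R by rewrite ltr0n.
have p01 : 0 <= p <= 1.
  rewrite divr_ge0 ?ler0n //= ler_pdivrMr ?ltr0n // mul1r ler_nat; exact: max_card.
(* [l] minimises the Chernoff exponent s l^2 / 8 - l t *)
pose l := 4 * t / s%:R; have l0 : 0 <= l by rewrite divr_ge0 ?mulr_ge0 // ltW.
pose c := expR (- (l * (s%:R * p + t))).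
have y0 : 0 <= expR l - 1 by rewrite subr_ge0 -expR0 ler_expR.
have mgf := sample_mgf_le A le_sT n0 y0; rewrite -/n -/p [1 + (_ - 1)]addrC subrK in mgf.
apply: (@le_trans _ _ ((\sum_(S : {set T} | #|S| == s) expR l ^+ #|S :&: A|) * c)).
  rewrite -sum1_card natr_sum mulr_suml [leLHS]big_mkcond [leRHS]big_mkcond /=.
  apply: ler_sum => S _; rewrite inE; case: (#|S| == s) => //=; case: ifP => [h|_].
    by rewrite -expRM_natl -expRD -[leLHS]expR0 ler_expR subr_ge0 mulrC ler_wpM2r.
  by rewrite mulr_ge0 ?exprn_ge0 ?expR_ge0.
apply: (@le_trans _ _ ('C(n, s)%:R * (1 + (expR l - 1) * p) ^+ s * c)).
  by rewrite ler_wpM2r ?expR_ge0.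
rewrite -mulrA ler_wpM2l ?ler0n //.
have h : 1 + (expR l - 1) * p <= expR (p * l + l ^+ 2 / 8).
  by have := hoeffding_bernoulli_mgf p01 l0; congr (_ <= _); ring.
apply: (@le_trans _ _ (expR (p * l + l ^+ 2 / 8) ^+ s * c)).
  rewrite ler_wpM2r ?expR_ge0 // lerXn2r // nnegrE ?expR_ge0 //.
  by rewrite addr_ge0 // mulr_ge0 //; case/andP: p01.
rewrite -expRM_natl -expRD ler_expR /l le_eqVlt; apply/orP; left; apply/eqP.
by field; exact: lt0r_neq0.
Qed.

(** A deficit in [A] is an excess in [~: A]. *)
Lemma sample_lower_tail (R : realType) (T : finType) (A : {set T}) (s : nat) (t : R) :
  (0 < s <= #|T|)%N -> 0 <= t ->
  #|[set S : {set T} | (#|S| == s) &&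
       (#|S :&: A|%:R <= s%:R * (#|A|%:R / #|T|%:R) - t)]|%:R
    <= 'C(#|T|, s)%:R * expR (- 2 * t ^+ 2 / s%:R).
Proof.
move=> sT t0; have /andP[s0 le_sT] := sT.
apply: le_trans (sample_upper_tail (~: A) sT t0); rewrite ler_nat subset_leq_card //.
apply/fintype.subsetP => S; rewrite !inE => /andP[/eqP cS h]; rewrite cS eqxx /=.
have n0 : #|T|%:R != 0 :> R by rewrite pnatr_eq0 -lt0n (leq_trans s0).
have -> : #|~: A|%:R = #|T|%:R - #|A|%:R :> R by rewrite -(cardsC A) natrD addrC addKr.
have -> : #|S :&: ~: A|%:R = s%:R - #|S :&: A|%:R :> R.
  by rewrite -cS -(cardsID A S) natrD addrC addKr finset.setDE.
by rewrite mulrBl divff //; lra.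
Qed.

(** * Ranks in the sample *)

Section Ranks.
Variables (disp : Order.disp_t) (T : orderType disp).
Implicit Type X : seq T.

Lemma count_lt_nth_sort (x0 : T) X (i : nat) :
  (count (fun x => x < nth x0 (sort <=%O X) i)%O X <= i)%N.
Proof.
rewrite leqNgt; apply/negP => h.
have /nth_count_lt : sorted <=%O (sort <=%O X) by exact: sort_le_sorted.
move=> /(_ (nth x0 (sort <=%O X) i) x0 i).
by rewrite ltxx (permP (permEl (perm_sort _ _))) => /(_ h).
Qed.

Lemma count_le_nth_sort (x0 : T) X (i : nat) : (i < size X)%N ->
  (i < count (fun x => x <= nth x0 (sort <=%O X) i)%O X)%N.
Proof.
move=> iX; rewrite ltnNge; apply/negP => h.
have /nth_count_gt : sorted <=%O (sort <=%O X) by exact: sort_le_sorted.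
move=> /(_ (nth x0 (sort <=%O X) i) x0 i).
by rewrite ltxx (permP (permEl (perm_sort _ _))) size_sort h iX => /(_ isT).
Qed.

Lemma count_positions (x0 : T) X n (P : pred T) : size X = n ->
  count P X = #|[set i : 'I_n | P (nth x0 X i)]|.
Proof.
move=> sX; rewrite -{1}(mkseq_nth x0 X) sX /mkseq count_map -val_enum_ord count_map.
by rewrite cardsE cardE -size_filter enumT.
Qed.

Lemma count_sample (x0 : T) X n (S : {set 'I_n}) (P : pred T) :
  count P [seq nth x0 X (val i) | i <- enum S]
    = #|S :&: [set i : 'I_n | P (nth x0 X i)]|.
Proof.
rewrite count_map -size_filter cardE; congr size.
rewrite /enum_mem -filter_predI; apply: eq_filter => i.
by rewrite /= !inE andbC.
Qed.

(** Encodes the positions of the [#|A|] smallest elements. Ties may be split between [A] and its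
    complement, so every cardinality is attained despite repeated values. *)
Definition initial_positions (x0 : T) X n (A : {set 'I_n}) :=
  forall a b : 'I_n, a \in A -> b \notin A -> (nth x0 X a <= nth x0 X b)%O.

Lemma initial_positions_ex (x0 : T) X n (j : nat) : (j <= n)%N ->
  exists2 A : {set 'I_n}, #|A| = j & initial_positions x0 X A.
Proof.
move=> le_jn; pose r (a b : 'I_n) := (nth x0 X a <= nth x0 X b)%O.
have r_tr : transitive r by move=> b a c; exact: le_trans.
have r_tot : total r by move=> a b; exact: le_total.
pose w := sort r (enum 'I_n).
have uw : uniq w by rewrite sort_uniq enum_uniq.
have sw : size w = n by rewrite size_sort size_enum_ord.
exists [set a in take j w].
  by rewrite cardsE (card_uniqP (take_uniq j uw)) size_takel // sw.
move=> a b; rewrite !inE => aw bw.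
have : pairwise r w by rewrite -sorted_pairwise // sort_sorted.
rewrite -(cat_take_drop j w) pairwise_cat => /and3P[/allrelP h _ _]; apply: h => //.
have : b \in w by rewrite mem_sort mem_enum.
by rewrite -{1}(cat_take_drop j w) mem_cat (negPf bw).
Qed.

Variables (x0 : T) (X : seq T) (n : nat) (A S : {set 'I_n}) (i : nat).
Hypotheses (sX : size X = n) (iniA : initial_positions x0 X A).
Let srt := sort <=%O [seq nth x0 X (val a) | a <- enum S].

(** Fewer than [i] sample elements are below the pivot, so some sampled position in [A] has a value
    at least the pivot. As [A] is initial, all elements below the pivot then sit in [A], and that
    position is left over. *)
Lemma initial_sample_ge : (0 < i <= #|S :&: A|)%N ->
  (count (fun x => x < nth x0 srt i.-1)%O X < #|A|)%N.
Proof.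
move=> /andP[i0 iSA]; set u := nth _ _ _.
pose L := [set a : 'I_n | (nth x0 X a < u)%O].
have SL : (#|S :&: L| < #|S :&: A|)%N.
  rewrite -(count_sample x0 X S (fun x => x < u)%O).
  apply: leq_ltn_trans (count_lt_nth_sort _ _ _) _.
  by rewrite prednK.
rewrite (count_positions x0 _ sX) -/L.
have [a aSA aL] : exists2 a, a \in S :&: A & a \notin L.
  apply/subsetPn; apply: contraL SL => sSAL; rewrite -leqNgt subset_leq_card //.
  by rewrite finset.subsetI finset.subsetIl.
move: aSA; rewrite inE => /andP[_ aA].
apply: proper_card; apply/properP; split; last by exists a.
apply/fintype.subsetP => b bL; apply: contraNT aL => bA.
by rewrite inE (le_lt_trans (iniA aA bA)) //; rewrite inE in bL.
Qed.

(** Dually, at least [i] sample elements are at most the pivot, so one of them lies outside [A], and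
    it dominates all of [A]. *)
Lemma initial_sample_lt : (#|S :&: A| < i <= #|S|)%N ->
  (#|A| < count (fun x => x <= nth x0 srt i.-1)%O X)%N.
Proof.
move=> /andP[iSA iS]; set u := nth _ _ _.
pose L := [set a : 'I_n | (nth x0 X a <= u)%O].
have i0 : (0 < i)%N by exact: leq_ltn_trans iSA.
have SL : (#|S :&: A| < #|S :&: L|)%N.
  rewrite -(count_sample x0 X S (fun x => x <= u)%O).
  apply: leq_trans iSA _; rewrite -{1}(prednK i0).
  by apply: count_le_nth_sort; rewrite size_map -cardE prednK.
rewrite (count_positions x0 _ sX) -/L.
have [b bSL bA] : exists2 b, b \in S :&: L & b \notin A.
  apply/subsetPn; apply: contraL SL => sSLA; rewrite -leqNgt subset_leq_card //.
  by rewrite finset.subsetI finset.subsetIl.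
move: bSL; rewrite !inE => /andP[_ bL].
apply: proper_card; apply/properP; split; last by exists b; rewrite ?inE.
by apply/fintype.subsetP => a aA; rewrite inE (le_trans (iniA aA bA)).
Qed.

End Ranks.

(** * Sample sizes and gaps *)

Section SampleSizes.
Variable R : realType.
Implicit Types (n m : nat).

Lemma fsel_ge0 n : 0 <= fsel R n.
Proof. by rewrite mulr_ge0 ?powR_ge0. Qed.

Lemma ln_nat_ge0 n : 0 <= ln n%:R :> R.
Proof. by case: n => [|n]; [rewrite ln0 | rewrite ln_ge0 // ler1n]. Qed.

(** Cubing removes the fractional powers; bounds on [fsel] are compared through cubes by
    [ler_cube]. *)
Lemma fsel_cube n : fsel R n ^+ 3 = n%:R ^+ 2 * ln n%:R.
Proof.
rewrite /fsel exprMn -!(powR_mulrn 3) ?powR_ge0 // -!powRrM.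
have -> : 2 / 3 * 3 = 2 :> R by field.
have -> : 1 / 3 * 3 = 1 :> R by field.
by rewrite powRr1 ?ln_nat_ge0 // powR_mulrn.
Qed.

Lemma ler_cube (x y : R) : 0 <= y -> x ^+ 3 <= y ^+ 3 -> x <= y.
Proof.
move=> y0; case: (lerP 0 x) => [x0|x0 _]; last exact: le_trans (ltW x0) y0.
by rewrite ler_pXn2r.
Qed.

Lemma ler_ln_nat m n : (m <= n)%N -> ln m%:R <= ln n%:R :> R.
Proof.
case: m => [|m] lemn; first by rewrite ln0 // ln_nat_ge0.
by rewrite ler_ln ?posrE ?ltr0n ?ler_nat // (leq_trans _ lemn).
Qed.

Lemma fsel_le m n : (m <= n)%N -> fsel R m <= fsel R n.
Proof.
move=> lemn; apply: ler_cube; first exact: fsel_ge0.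
rewrite !fsel_cube ler_pM ?sqr_ge0 ?ln_nat_ge0 ?ler_ln_nat //.
by rewrite lerXn2r ?nnegrE ?ler0n // ler_nat.
Qed.

(** Shrinking the size by 64 shrinks n^(2/3) by 16, so an eighth leaves room. This is the
    contraction that closes the recurrence. *)
Lemma fsel_le_eighth m n : m%:R <= n%:R / 64 :> R -> fsel R m <= fsel R n / 8.
Proof.
move=> lemn; have n0 : 0 <= n%:R :> R by [].
have m0 : 0 <= m%:R :> R by [].
have lemn' : (m <= n)%N by rewrite -(ler_nat R); lra.
apply: ler_cube; first by rewrite divr_ge0 ?fsel_ge0.
rewrite [leRHS]exprMn !fsel_cube [leRHS]mulrAC ler_pM ?sqr_ge0 ?ln_nat_ge0 ?ler_ln_nat //.
have h : m%:R ^+ 2 <= (n%:R / 64) ^+ 2 :> R by rewrite lerXn2r ?nnegrE //; lra.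
apply: le_trans h _; rewrite exprMn ler_wpM2l ?sqr_ge0 //; lra.
Qed.

(** In cubes the claim is ln n <= d^3 n, which follows from ln n = 2 ln (sqrt n) <= 2 sqrt n once
    sqrt n > 2 / d^3. *)
Lemma fsel_small (d : R) : 0 < d ->
  exists N, forall n, (N <= n)%N -> fsel R n <= d * n%:R.
Proof.
move=> d0; pose c := (2 / d ^+ 3) ^+ 2.
have d3 : 0 < d ^+ 3 by rewrite exprn_gt0.
exists (Num.truncn c).+1 => n; rewrite truncn_lt_nat ?sqr_ge0 // => cn.
have n0 : 0 < n%:R :> R by apply: le_lt_trans cn; exact: sqr_ge0.
apply: ler_cube; first by rewrite mulr_ge0 // ltW.
have lnn : ln n%:R <= d ^+ 3 * n%:R.
  set r := Num.sqrt n%:R : R; have r0 : 0 < r by rewrite sqrtr_gt0.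
  have nr : n%:R = r ^+ 2 :> R by rewrite sqr_sqrtr // ltW.
  have cr : 2 / d ^+ 3 < r.
    rewrite -(ltr_pXn2r (n := 2)) ?nnegrE ?(ltW r0) -?nr //.
    by rewrite divr_ge0 // ltW.
  have -> : ln n%:R = ln r *+ 2 by rewrite nr lnXn.
  have := ln_sublinear r0; move: cr; rewrite ltr_pdivrMr // nr => cr lr.
  rewrite -mulr_natr; nra.
rewrite fsel_cube (_ : (d * n%:R) ^+ 3 = n%:R ^+ 2 * (d ^+ 3 * n%:R)); last by ring.
by rewrite ler_wpM2l ?sqr_ge0.
Qed.

(** This is n^(-1/3) for n >= 1. *)
Definition fail_prob n : R := expR (- (ln n%:R / 3)).

Lemma fail_prob_ge0 n : 0 <= fail_prob n. Proof. exact: expR_ge0. Qed.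

Lemma fail_prob_cube n : (0 < n)%N -> fail_prob n ^+ 3 = n%:R^-1.
Proof.
move=> n0; rewrite -expRM_natl (_ : 3%:R * _ = - ln n%:R); last by field.
by rewrite expRN lnK // posrE ltr0n.
Qed.

(** Since g^2 = beta s ln n, the square is beta n^2 ln n / s. With s of order f, this makes q of
    order f. *)
Lemma gsel_scaled_sqr (alpha beta : R) n : 0 <= beta -> (0 < ssel alpha n)%N ->
  (gsel alpha beta n * n%:R / (ssel alpha n)%:R) ^+ 2
    = beta * fsel R n ^+ 3 / (ssel alpha n)%:R.
Proof.
move=> b0 s0; have s0' : (ssel alpha n)%:R != 0 :> R by rewrite pnatr_eq0 -lt0n.
rewrite fsel_cube !exprMn exprVn sqr_sqrtr; first by field.
by rewrite !mulr_ge0 ?ln_nat_ge0.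
Qed.

(** The exponent is - 2 beta ln n, and beta >= 1/6 brings it below - (ln n) / 3. *)
Lemma expR_gsel_le (alpha beta : R) n : 1 / 6 <= beta -> (0 < ssel alpha n)%N ->
  expR (- 2 * gsel alpha beta n ^+ 2 / (ssel alpha n)%:R) <= fail_prob n.
Proof.
move=> b6 s0; have s0' : (ssel alpha n)%:R != 0 :> R by rewrite pnatr_eq0 -lt0n.
have l0 := ln_nat_ge0 n; have b0 : 0 <= beta by lra.
rewrite ler_expR sqr_sqrtr; last by rewrite !mulr_ge0.
rewrite (_ : _ / _ = - (2 * beta * ln n%:R)); last by field.
by rewrite lerN2; nra.
Qed.

Lemma large_n_params (alpha beta : R) : 0 < alpha -> 1 / 6 <= beta ->
  exists (N : nat) (K : R), 0 < K /\ forall n, (N <= n)%N ->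
    let s := ssel alpha n in let q := gsel alpha beta n * n%:R / s%:R in
    [/\ (1 < n)%N /\ (0 < s)%N, 1 <= fsel R n /\ s%:R <= K * fsel R n,
        q <= K * fsel R n /\ s%:R <= n%:R / 64 :> R, 4 * q + 2 <= n%:R / 64 &
        fail_prob n * n%:R <= fsel R n /\ fail_prob n <= 1 / 16].
Proof.
move=> a0 b6; set c := Num.sqrt (beta / alpha).
have c0 : 0 <= c by exact: sqrtr_ge0.
(* Chosen so that f <= d n puts both s <= (alpha + 1) f and 4 q + 2 <= (4 c + 2) f below n / 64. *)
pose d := (64 * (alpha + 1 + (4 * c + 2)))^-1.
have d0 : 0 < d by rewrite invr_gt0; lra.
have [N1 smallN] := fsel_small d0.
pose N2 := (Num.truncn (expR 1 : R)).+1.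
(* [N1] gives f <= d n, [N2] gives ln n >= 1, and 16^3 gives n^(-1/3) <= 1/16. *)
exists (maxn (maxn N1 N2) (16 ^ 3)), (alpha + 1 + c); split; first lra.
move=> n; rewrite !geq_max => /andP[/andP[N1n N2n] n16] s q.
have n1 : (1 < n)%N by exact: leq_trans n16.
have n0 : (0 < n)%N by exact: ltnW.
have fail16 : fail_prob n <= 1 / 16.
  apply: ler_cube; first lra.
  rewrite fail_prob_cube // div1r exprVn lef_pV2 ?posrE ?exprn_gt0 ?ltr0n //.
  by rewrite -natrX ler_nat.
clear n16.
have n0' : 0 < n%:R :> R by rewrite ltr0n.
have n1' : 1 <= n%:R :> R by rewrite ler1n.
have lnn : 1 <= ln n%:R :> R.
  rewrite -[leLHS]expRK ler_ln ?posrE ?expR_gt0 //.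
  by apply: ltW; rewrite -truncn_lt_nat ?expR_ge0.
set f := fsel R n; have f0 : 0 <= f by exact: fsel_ge0.
have fcube : f ^+ 3 = n%:R ^+ 2 * ln n%:R by exact: fsel_cube.
have n2 : n%:R ^+ 2 <= f ^+ 3 by rewrite fcube ler_peMr ?sqr_ge0.
have f1 : 1 <= f by apply: ler_cube => //; apply: le_trans n2; nra.
have fd : (alpha + 1 + (4 * c + 2)) * f <= n%:R / 64.
  have D0 : 0 < alpha + 1 + (4 * c + 2) by lra.
  rewrite -ler_pdivlMl //; apply: le_trans (smallN n N1n) _.
  rewrite /d le_eqVlt; apply/orP; left; apply/eqP; field; lra.
have cf0 : 0 <= c * f by rewrite mulr_ge0.
have af0 : 0 < alpha * f by rewrite mulr_gt0 //; lra.
have ceilE : (`|Num.ceil (alpha * f)|%N)%:R = (Num.ceil (alpha * f))%:~R :> R.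
  by rewrite -[LHS]/((Posz `|Num.ceil (alpha * f)|)%:~R) gez0_abs // ltW // ceil_gt0.
have ceil_lt : (`|Num.ceil (alpha * f)|%N)%:R < alpha * f + 1.
  by rewrite ceilE; have := ceilB1_lt (alpha * f); rewrite intrB; lra.
have sE : s = `|Num.ceil (alpha * f)|%N.
  apply/minn_idPl; rewrite -ltnS prednK // -(ltr_nat R); lra.
have s_ge : alpha * f <= s%:R by rewrite sE ceilE ceil_ge.
have s_le : s%:R <= alpha * f + 1 by rewrite sE ltW.
have s0 : (0 < s)%N by rewrite -(ltr_nat R); lra.
(* From s >= alpha f, q^2 = beta f^3 / s <= (beta / alpha) f^2. *)
have qf : q <= c * f.
  have q0 : 0 <= q by rewrite divr_ge0 ?mulr_ge0 ?sqrtr_ge0.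
  rewrite -(ler_pXn2r (n := 2)) ?nnegrE // /q gsel_scaled_sqr //; last lra.
  rewrite -/f -/s [leRHS]exprMn [c ^+ 2]sqr_sqrtr; last by rewrite divr_ge0 //; lra.
  rewrite ler_pdivrMr ?ltr0n //.
  have -> : beta * f ^+ 3 = beta / alpha * f ^+ 2 * (alpha * f).
    by field; lra.
  by rewrite ler_wpM2l // mulr_ge0 ?sqr_ge0 // divr_ge0 //; lra.
split; [split=> // | split=> // | split | lra | split].
- lra.
- lra.
- lra.
- apply: ler_cube => //; rewrite exprMn fail_prob_cube // exprS mulKf //.
  exact: lt0r_neq0.
- exact: fail16.
Qed.

End SampleSizes.

(** * Rounding and clipping of the pivot ranks *)

Section PivotRanks.
Variables (R : realType) (alpha beta : R) (n k : nat).
Hypotheses (k1n : (1 <= k <= n)%N) (s0 : (0 < ssel alpha n)%N).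
Let s := ssel alpha n.
Let g := gsel alpha beta n.
Let x : R := k%:R * s%:R / n%:R.

Let n0 : 0 < n%:R :> R.
Proof. by rewrite ltr0n; case/andP: k1n => h /(leq_trans h). Qed.

Let x0 : 0 < x.
Proof. by rewrite divr_gt0 // mulr_gt0 ?ltr0n //; case/andP: k1n. Qed.

Let xs : x <= s%:R.
Proof. by rewrite ler_pdivrMr // mulrC ler_wpM2l // ler_nat; case/andP: k1n. Qed.

Let g0 : 0 <= g. Proof. exact: sqrtr_ge0. Qed.

Lemma iu_selE : (iu_sel alpha beta n k)%:Z = Num.max (Num.ceil (x - g)) 1.
Proof. by rewrite /iu_sel gez0_abs // le_max ler01 orbT. Qed.

Lemma iv_selE : (iv_sel alpha beta n k)%:Z = Num.min (Num.ceil (x + g)) s%:Z.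
Proof.
rewrite /iv_sel gez0_abs // le_min lez_nat leq0n andbT ceil_ge0 -/x -/g.
by have := x0; have := g0; lra.
Qed.

Lemma iu_sel_gt0 : (0 < iu_sel alpha beta n k)%N.
Proof. by rewrite -ltz_nat iu_selE lt_max ltr01 orbT. Qed.

Lemma iu_iv_sel : (iu_sel alpha beta n k <= iv_sel alpha beta n k)%N.
Proof.
rewrite -lez_nat iu_selE iv_selE ge_max !le_min.
rewrite le_ceil /=; last by have := g0; lra.
rewrite ceil_le_int -(gtz0_ge1 (Num.ceil (x + g))) ceil_gt0.
have -> : x - g <= s%:Z%:~R by have := xs; have := g0; rewrite -[s%:Z%:~R]/(s%:R); lra.
by rewrite ltr_wpDr //= -(ltz_nat 0).
Qed.

Lemma iv_sel_le : (iv_sel alpha beta n k <= s)%N.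
Proof. by rewrite -lez_nat iv_selE ge_min lexx orbT. Qed.

Lemma iu_sel_ge : x - g <= (iu_sel alpha beta n k)%:R.
Proof.
rewrite -[_%:R]/((Posz (iu_sel alpha beta n k))%:~R) iu_selE -ceil_le_int.
by rewrite le_max lexx.
Qed.

(** The hypothesis makes the clip at 1 inactive; in [iv_sel_ge] the hypothesis does the same for the
    clip at [s]. *)
Lemma iu_sel_lt : 0 < x - g -> (iu_sel alpha beta n k)%:R - 1 < x - g.
Proof.
move=> h; rewrite -[_%:R]/((Posz (iu_sel alpha beta n k))%:~R) iu_selE.
rewrite max_l; last by rewrite -gtz0_ge1 ceil_gt0.
by have := ceilB1_lt (x - g); rewrite intrB.
Qed.

Lemma iv_sel_lt : (iv_sel alpha beta n k)%:R - 1 < x + g.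
Proof.
apply: le_lt_trans (ceilB1_lt (x + g)); rewrite intrB lerD2r.
rewrite -[_%:R]/((Posz (iv_sel alpha beta n k))%:~R) ler_int iv_selE.
by rewrite ge_min lexx.
Qed.

Lemma iv_sel_ge : x + g <= s%:R -> x + g <= (iv_sel alpha beta n k)%:R.
Proof.
move=> h; rewrite -[_%:R]/((Posz (iv_sel alpha beta n k))%:~R) iv_selE -ceil_le_int.
by rewrite le_min lexx ceil_le_int.
Qed.

End PivotRanks.

(** * Pivots *)

Section PivotEvents.
Variables (R : realType) (alpha beta : R) (beta6 : 1 / 6 <= beta).
Variables (disp : Order.disp_t) (T : orderType disp).
Variables (x0 : T) (X : seq T) (n k : nat).
Hypotheses (sX : size X = n) (k1n : (1 <= k <= n)%N) (s_gt0 : (0 < ssel alpha n)%N).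
Let s := ssel alpha n.
Let g := gsel alpha beta n.
Let q : R := g * n%:R / s%:R.
Let iu := iu_sel alpha beta n k.
Let iv := iv_sel alpha beta n k.

Definition sample_sort (S : {set 'I_n}) : seq T :=
  sort <=%O [seq nth x0 X (val i) | i <- enum S].
Definition pivot_u (S : {set 'I_n}) : T := nth x0 (sample_sort S) iu.-1.
Definition pivot_v (S : {set 'I_n}) : T := nth x0 (sample_sort S) iv.-1.

(** States, by counting samples, that [bad] has probability at most c n^(-1/3). *)
Definition rare (c : R) (bad : pred {set 'I_n}) : Prop :=
  #|[set S : {set 'I_n} | (#|S| == s) && bad S]|%:R <= 'C(n, s)%:R * (c * fail_prob R n).

Lemma rareU c d bad1 bad2 :
  rare c bad1 -> rare d bad2 -> rare (c + d) (fun S => bad1 S || bad2 S).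
Proof.
move=> r1 r2; rewrite /rare !mulrDl mulrDr; apply: le_trans (lerD r1 r2).
rewrite -natrD ler_nat; apply: leq_trans (leq_card_setU _ _); apply: subset_leq_card.
by apply/fintype.subsetP => S; rewrite !inE => /andP[-> /orP[]->]; rewrite ?orbT.
Qed.

Lemma rare0 : rare 1 (fun=> false).
Proof.
rewrite /rare (_ : [set S | _] = finset.set0).
  by rewrite cards0 mul1r mulr_ge0 ?fail_prob_ge0.
by apply/finset.setP => S; rewrite !inE andbF.
Qed.

Let n0 : 0 < n%:R :> R.
Proof. by rewrite ltr0n; case/andP: k1n => h /(leq_trans h). Qed.

Let s0 : 0 < s%:R :> R. Proof. by rewrite ltr0n. Qed.

Let s_le_n : (0 < s <= #|'I_n|)%N.
Proof. by rewrite s_gt0 card_ord /s /ssel (leq_trans (geq_minr _ _)) ?leq_pred. Qed.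

Let g0 : 0 <= g. Proof. exact: sqrtr_ge0. Qed.

Lemma rare_upper (A : {set 'I_n}) (bad : pred {set 'I_n}) :
  (forall S, bad S -> s%:R * (#|A|%:R / n%:R) + g <= #|S :&: A|%:R :> R) -> rare 1 bad.
Proof.
move=> badA; have := sample_upper_tail A s_le_n g0; rewrite card_ord => tail.
rewrite /rare mul1r; apply: le_trans (_ : _ <= 'C(n, s)%:R * expR _) _; last first.
  by rewrite ler_wpM2l //; exact: (expR_gsel_le beta6 s_gt0).
apply: le_trans tail; rewrite ler_nat subset_leq_card //.
by apply/fintype.subsetP => S; rewrite !inE => /andP[-> /badA].
Qed.

Lemma rare_lower (A : {set 'I_n}) (bad : pred {set 'I_n}) :
  (forall S, bad S -> #|S :&: A|%:R <= s%:R * (#|A|%:R / n%:R) - g :> R) -> rare 1 bad.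
Proof.
move=> badA; have := sample_lower_tail A s_le_n g0; rewrite card_ord => tail.
rewrite /rare mul1r; apply: le_trans (_ : _ <= 'C(n, s)%:R * expR _) _; last first.
  by rewrite ler_wpM2l //; exact: (expR_gsel_le beta6 s_gt0).
apply: le_trans tail; rewrite ler_nat subset_leq_card //.
by apply/fintype.subsetP => S; rewrite !inE => /andP[-> /badA].
Qed.

(** A shift by [z * g] in sample rank corresponds to a shift by [z * q] in rank within [X]. *)
Let rank_scaled (z : R) :
  k%:R * s%:R / n%:R + z * g = s%:R * ((k%:R + z * q) / n%:R).
Proof. by rewrite /q; field; rewrite !lt0r_neq0. Qed.

Lemma count_gt_le (v : T) :
  (count (fun x => v < x)%O X + count (fun x => x <= v)%O X = n)%N.
Proof.
rewrite -sX -(count_predC (fun x => v < x)%O X); congr addn.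
by apply: eq_count => x /=; rewrite leNgt.
Qed.

(** Take [A] initial of size j = ceil (k + 2 q). The mean of |S /\ A| is at least x + 2 g, where x =
    k s / n, so off the tail event |S /\ A| > x + g > i_v - 1 and fewer than j elements are below v.
    If such a j could exceed n, the bound is trivial. *)
Lemma pivot_v_upper : exists2 bad, rare 1 bad & forall S : {set 'I_n}, #|S| = s -> ~~ bad S ->
  (count (fun x => x < pivot_v S)%O X)%:R <= k%:R + 2 * q + 1.
Proof.
have q0 : 0 <= q by rewrite divr_ge0 ?mulr_ge0.
have k0 : 0 <= k%:R :> R by [].
case: (lerP n%:R (k%:R + 2 * q + 1)) => [big|small].
  exists (fun=> false) => [|S _ _]; first exact: rare0.
  by apply: le_trans big; rewrite ler_nat -sX count_size.
pose j := `|Num.ceil (k%:R + 2 * q)|%N.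
have jE : j%:R = (Num.ceil (k%:R + 2 * q))%:~R :> R.
  rewrite -[LHS]/((Posz j)%:~R) gez0_abs // ceil_ge0; lra.
have j_ge : k%:R + 2 * q <= j%:R by rewrite jE ceil_ge.
have j_lt : j%:R < k%:R + 2 * q + 1.
  by rewrite jE; have := ceilB1_lt (k%:R + 2 * q); rewrite intrB; lra.
have jn : (j <= n)%N by rewrite -(ler_nat R); lra.
have [A cA iniA] := initial_positions_ex x0 X jn.
exists (fun S : {set 'I_n} => #|S :&: A|%:R <= s%:R * (#|A|%:R / n%:R) - g :> R).
  exact: (@rare_lower A).
move=> S cS; rewrite -ltNge cA => h.
have ivA : (0 < iv <= #|S :&: A|)%N.
  rewrite (leq_trans (iu_sel_gt0 _ _ _ _) (iu_iv_sel beta k1n s_gt0)) /=.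
  rewrite -ltnS -(ltr_nat R) -natr1.
  have := iv_sel_lt beta k1n s_gt0; rewrite -/iv -/s -/g.
  have : k%:R * s%:R / n%:R + 2 * g <= s%:R * (j%:R / n%:R).
    by rewrite rank_scaled ler_pM2l // ler_pM2r ?invr_gt0.
  lra.
have := initial_sample_ge sX iniA ivA; rewrite cA -(ltr_nat R) => ?.
by apply: ltW; apply: lt_trans j_lt.
Qed.

(** The mirror image, with j = floor (k - 2 q): off the tail event |S /\ A| < x - g <= i_u, so more
    than j elements are at most u. *)
Lemma pivot_u_lower : exists2 bad, rare 1 bad & forall S : {set 'I_n}, #|S| = s -> ~~ bad S ->
  (count (fun x => pivot_u S < x)%O X)%:R <= n%:R - k%:R + 2 * q + 1.
Proof.
have k0 : k%:R <= n%:R :> R by rewrite ler_nat; case/andP: k1n.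
case: (ltrP (k%:R - 2 * q) 0) => [big|small].
  exists (fun=> false) => [|S _ _]; first exact: rare0.
  apply: (@le_trans _ _ n%:R); last lra.
  by rewrite ler_nat -sX count_size.
pose j := Num.truncn (k%:R - 2 * q).
have /andP[j_le j_gt] := truncn_itv small; rewrite -/j -natr1 in j_le j_gt.
have q0 : 0 <= q by rewrite divr_ge0 ?mulr_ge0.
have jn : (j <= n)%N by rewrite -(ler_nat R); lra.
have [A cA iniA] := initial_positions_ex x0 X jn.
exists (fun S : {set 'I_n} => s%:R * (#|A|%:R / n%:R) + g <= #|S :&: A|%:R :> R).
  exact: (@rare_upper A).
move=> S cS; rewrite -ltNge cA => h.
have iuA : (#|S :&: A| < iu <= #|S|)%N.
  rewrite cS (leq_trans (iu_iv_sel beta k1n s_gt0) (iv_sel_le _ k1n s_gt0)) andbT.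
  rewrite -(ltr_nat R); have := iu_sel_ge alpha beta n k; rewrite -/iu -/s -/g.
  have : s%:R * (j%:R / n%:R) <= k%:R * s%:R / n%:R + (- 2) * g.
    by rewrite rank_scaled ler_pM2l // ler_pM2r ?invr_gt0 //; lra.
  lra.
have := initial_sample_lt sX iniA iuA; rewrite cA -(ltr_nat R) -[nth _ _ _]/(pivot_u S).
have : n%:R = (count (fun x => pivot_u S < x)%O X)%:R
    + (count (fun x => x <= pivot_u S)%O X)%:R :> R.
  by rewrite -natrD count_gt_le.
lra.
Qed.

Lemma pivot_u_le_target : exists2 bad, rare 1 bad & forall S : {set 'I_n}, #|S| = s -> ~~ bad S ->
  0 < k%:R * s%:R / n%:R - g -> (count (fun x => x < pivot_u S)%O X < k)%N.
Proof.
have kn : (k <= n)%N by case/andP: k1n.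
have [A cA iniA] := initial_positions_ex x0 X kn.
exists (fun S : {set 'I_n} => #|S :&: A|%:R <= s%:R * (#|A|%:R / n%:R) - g :> R).
  exact: (@rare_lower A).
move=> S cS; rewrite -ltNge cA => h /iu_sel_lt iu_lt.
have iuA : (0 < iu <= #|S :&: A|)%N.
  rewrite iu_sel_gt0 /= -ltnS -(ltr_nat R) -natr1.
  move: iu_lt; rewrite -/iu -/s -/g.
  have -> : k%:R * s%:R / n%:R = s%:R * (k%:R / n%:R) :> R by ring.
  lra.
by have := initial_sample_ge sX iniA iuA; rewrite cA.
Qed.

(** Here [A] has k - 1 positions, because [initial_sample_lt] gives strictly more than [#|A|]
    elements at most v, that is, at least k. *)
Lemma pivot_v_ge_target : exists2 bad, rare 1 bad & forall S : {set 'I_n}, #|S| = s -> ~~ bad S ->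
  k%:R * s%:R / n%:R + g <= s%:R ->
  (k <= n - count (fun x => pivot_v S < x)%O X)%N.
Proof.
have /andP[k0 kn] := k1n.
have [A cA iniA] := initial_positions_ex x0 X (leq_trans (leq_pred k) kn).
exists (fun S : {set 'I_n} => s%:R * (#|A|%:R / n%:R) + g <= #|S :&: A|%:R :> R).
  exact: (@rare_upper A).
move=> S cS; rewrite -ltNge cA => h /(iv_sel_ge k1n s_gt0) iv_ge.
have ivA : (#|S :&: A| < iv <= #|S|)%N.
  rewrite cS (iv_sel_le _ k1n s_gt0) andbT -(ltr_nat R).
  move: iv_ge; rewrite -/iv -/s -/g.
  have : s%:R * (k.-1%:R / n%:R) <= s%:R * (k%:R / n%:R) :> R.
    by rewrite ler_pM2l // ler_pM2r ?invr_gt0 // ler_nat leq_pred.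
  have -> : k%:R * s%:R / n%:R = s%:R * (k%:R / n%:R) :> R by ring.
  lra.
have := initial_sample_lt sX iniA ivA; rewrite cA prednK // -[nth _ _ _]/(pivot_v S).
by rewrite -[X in (_ <= X - _)%N](count_gt_le (pivot_v S)) addKn.
Qed.

(** The last two clauses are conditional because near the ends, k <= q or k > n - q, a pivot rank
    may be clipped. There the first two clauses already make the outer list short. *)
Definition good_pivots (S : {set 'I_n}) : Prop :=
  [/\ (count (fun x => x < pivot_v S)%O X)%:R <= k%:R + 2 * q + 1,
      (count (fun x => pivot_u S < x)%O X)%:R <= n%:R - k%:R + 2 * q + 1,
      q < k%:R -> (count (fun x => x < pivot_u S)%O X < k)%N &
      k%:R + q <= n%:R -> (k <= n - count (fun x => pivot_v S < x)%O X)%N].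

Lemma good_pivots_likely : exists2 bad, rare 4 bad &
  forall S : {set 'I_n}, #|S| = s -> ~~ bad S -> good_pivots S.
Proof.
have [b1 r1 h1] := pivot_v_upper; have [b2 r2 h2] := pivot_u_lower.
have [b3 r3 h3] := pivot_u_le_target; have [b4 r4 h4] := pivot_v_ge_target.
exists (fun S : {set 'I_n} => (b1 S || b2 S) || (b3 S || b4 S)).
  have -> : 4 = (1 + 1) + (1 + 1) :> R by ring.
  by apply: rareU; apply: rareU.
move=> S cS; rewrite !negb_or => /andP[/andP[n1 n2] /andP[n3 n4]].
have gE : g = q * (s%:R / n%:R) by rewrite /q; field; rewrite !lt0r_neq0.
have sn0 : 0 < s%:R / n%:R :> R by exact: divr_gt0.
split; [exact: h1 | exact: h2 | move=> qk; apply: h3 => // | move=> kq; apply: h4 => //].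
  by rewrite gE -mulrA -mulrBl mulr_gt0 // subr_gt0.
by rewrite gE -mulrA -mulrDl mulrA ler_pdivrMr // mulrC ler_pM2l.
Qed.

End PivotEvents.

(** * One round of SELECT *)

Section Round.
Variables (R : realType) (alpha beta : R).
Variables (disp : Order.disp_t) (T : orderType disp).

Section Steps.
Variables (x0 : T) (X : seq T) (k : nat) (S : {set 'I_(size X)}).
Let n := size X.
Let u := pivot_u alpha beta x0 X k S.
Let v := pivot_v alpha beta x0 X k S.

Definition step4_count : nat :=
  (\sum_(x <- [seq nth x0 X (val i) | i <- enum (~: S)])
     (if (2 * k < n)%N then 1 + ((x < v)%O && (u < v)%O)
      else 1 + ((u < x)%O && (u < v)%O)))%N.

Definition step7_cost (cost : seq T -> nat -> R) : R :=
  let cL := count (fun x => (x < u)%O) X in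
  let cLU := count (fun x => (x <= u)%O) X in
  let cLUM := count (fun x => (x <= u)%O || ((u < x)%O && (x < v)%O)) X in
  let cR := count (fun x => (v < x)%O) X in
  if (cL < k <= cLU)%N then 0
  else if (cLUM < k <= n - cR)%N then 0
  else if (k <= cL)%N then cost (seq.filter (fun x => (x < u)%O) X) k
  else if (n - cR < k)%N then
    cost (seq.filter (fun x => (v < x)%O) X) (k - (n - cR))%N
  else cost (seq.filter (fun x => (u < x)%O && (x < v)%O) X) (k - cLU)%N.

(** The recursive calls are a parameter, so that one estimate serves both the crude bound and the
    final induction. *)
Definition round_cost (cost : seq T -> nat -> R) : R :=
  let iu := iu_sel alpha beta n k in
  let iv := iv_sel alpha beta n k in
  step4_count%:R + cost [seq nth x0 X (val i) | i <- enum S] iu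
  + (if (iu < iv)%N then cost (drop iu (sample_sort x0 X S)) (iv - iu)%N else 0)
  + step7_cost cost.

(* The last case, with [h = |M|], is inclusion-exclusion for M = {u < x} /\ {x < v}. *)
Definition step7_size (h : nat) : Prop :=
  [\/ h = 0%N,
      (k <= count (fun x => x < u)%O X)%N /\ h = count (fun x => x < u)%O X,
      (n - count (fun x => v < x)%O X < k)%N /\ h = count (fun x => v < x)%O X |
      (h + n = count (fun x => x < v)%O X + count (fun x => u < x)%O X)%N].

Lemma count_rest_le (P : pred T) :
  (count P [seq nth x0 X (val i) | i <- enum (~: S)] <= count P X)%N.
Proof.
rewrite count_sample (count_positions x0 P (erefl (size X))).
by rewrite subset_leq_card // finset.subsetIr.
Qed.

Lemma size_rest_le : (size [seq nth x0 X (val i) | i <- enum (~: S)] <= n)%N.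
Proof. by rewrite size_map -cardE (leq_trans (max_card _)) // card_ord. Qed.

(** The second comparison is charged to every [x < v], respectively [u < x], in the whole of [X]. *)
Lemma step4_count_le : (step4_count <=
  n + (if (2 * k < n)%N then count (fun x => x < v)%O X else count (fun x => u < x)%O X))%N.
Proof.
have andb_le (a b : bool) : (a && b <= if a then 1 else 0)%N by case: a; case: b.
rewrite /step4_count; case: ifP => _.
all: rewrite big_split /= sum1_size leq_add ?size_rest_le //.
all: apply: leq_trans (count_rest_le _); rewrite -sum1_count [leqRHS]big_mkcond /=.
all: by apply: leq_sum => x _; exact: andb_le.
Qed.

Lemma step4_count_le2 : (step4_count <= 2 * n)%N.
Proof.
apply: leq_trans step4_count_le _; rewrite [leqRHS]mul2n -addnn leq_add2l.
by case: ifP => _; rewrite /n count_size.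
Qed.

Hypotheses (k1n : (1 <= k <= n)%N) (uX : u \in X) (vX : v \in X).

(** The recursive list omits a pivot, which is an entry of [X], hence [h < n]. *)
Lemma step7_cost_le (cost : seq T -> nat -> R) (B : nat -> R) :
  (forall m, 0 <= B m) ->
  (forall (Y : seq T) j, (1 <= j <= size Y)%N -> cost Y j <= B (size Y)) ->
  exists h : nat, [/\ (h < n)%N, step7_cost cost <= B h &
    step7_size h].
Proof.
move=> B0 costB; have /andP[k0 kn] := k1n.
have n_gt0 : (0 < n)%N by exact: leq_trans kn.
have count_lt (P : pred T) y : y \in X -> ~~ P y -> (count P X < n)%N.
  move=> yX nPy; rewrite /n -(count_predC P X) -addn1 leq_add2l -has_count.
  by apply/hasP; exists y.
have none : step7_cost cost = 0 ->
    exists h : nat, [/\ (h < n)%N, step7_cost cost <= B h & step7_size h].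
  by move=> ->; exists 0%N; split=> //; constructor 1.
move: none; rewrite /step7_cost; case: ifP => [_ none|nU]; first exact: none.
case: ifP => [_ none|nV _]; first exact: none.
case: ifP => [kL|nL].
  exists (count (fun x => x < u)%O X); split; last by constructor 2.
    by apply: (count_lt _ u) => //; rewrite ltxx.
  by rewrite -size_filter; apply: costB; rewrite size_filter k0.
case: ifP => [kR|nR].
  exists (count (fun x => v < x)%O X); split; last by constructor 3.
    by apply: (count_lt _ v) => //; rewrite ltxx.
  rewrite -size_filter; apply: costB; rewrite size_filter.
  have := count_size (fun x => v < x)%O X; rewrite -/n; lia.
set M := fun x : T => (u < x)%O && (x < v)%O.
have cLUM : count (fun x => (x <= u)%O || ((u < x)%O && (x < v)%O)) X =
    (count (fun x => x <= u)%O X + count M X)%N.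
  rewrite -count_predUI -[LHS]addn0; congr addn.
  rewrite -(count_pred0 X); apply: eq_count => x /=; rewrite /M.
  by case: leP => //= ?.
rewrite cLUM in nV.
(* Failing the tests for L and U gives k > |L u U|; failing those for R and V gives k <= |L u U u
   M|. *)
have j_ok : (1 <= k - count (fun x => x <= u)%O X <= count M X)%N.
  by move: nU nV nL nR; lia.
have uv : (u < v)%O.
  have : has M X by rewrite has_count; case/andP: j_ok => h /(leq_trans h).
  by case/hasP => x _ /andP[/lt_trans]; apply.
exists (count M X); split.
- by apply: (count_lt _ u) => //; rewrite /M ltxx.
- by rewrite -(size_filter M); apply: costB; rewrite size_filter.
(* As u < v, every element satisfies x < v or u < x, so the union is all of [X]. *)
constructor 4; rewrite -count_predUI addnC; congr addn; last first.
  by apply: eq_count => x; rewrite /M /= andbC.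
rewrite /n -[LHS]count_predT; apply: eq_count => x /=.
by case: (leP v x) => //= vx; rewrite (lt_le_trans uv).
Qed.

End Steps.

Lemma sel_costS fuel (X : seq T) k x0 X' : X = x0 :: X' ->
  sel_cost alpha beta fuel.+1 X k =
  if size X == 1%N then 0 else
  (\sum_(S : {set 'I_(size X)} | #|S| == ssel alpha (size X))
     round_cost x0 k S (sel_cost alpha beta fuel))
  / 'C(size X, ssel alpha (size X))%:R.
Proof.
move=> ->; rewrite -[X in 'C(X, _)](card_ord (size (x0 :: X'))) -card_draws.
by [].
Qed.

Lemma pivots_in (x0 : T) X k (S : {set 'I_(size X)}) : x0 \in X ->
  pivot_u alpha beta x0 X k S \in X /\ pivot_v alpha beta x0 X k S \in X.
Proof.
move=> x0X; have nthX i : nth x0 (sample_sort x0 X S) i \in X.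
  (* An index past the end returns the default [x0], itself an entry of [X]. *)
  have [lt_i|le_i] := ltnP i (size (sample_sort x0 X S)); last by rewrite nth_default.
  have := mem_nth x0 lt_i; rewrite mem_sort => /mapP[j _ ->].
  exact: mem_nth (ltn_ord j).
by split; exact: nthX.
Qed.

Lemma pivots_le (x0 : T) X k (S : {set 'I_(size X)}) :
  (1 <= k <= size X)%N -> (0 < ssel alpha (size X))%N -> #|S| = ssel alpha (size X) ->
  (pivot_u alpha beta x0 X k S <= pivot_v alpha beta x0 X k S)%O.
Proof.
move=> k1n s0 cS.
have uv := iu_iv_sel beta k1n s0; have vs := iv_sel_le beta k1n s0.
have u0 := iu_sel_gt0 alpha beta (size X) k.
have sz : size (sample_sort x0 X S) = ssel alpha (size X).
  by rewrite size_sort size_map -cardE cS.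
have sorted_s : sorted <=%O (sample_sort x0 X S) by exact: sort_le_sorted.
apply: (sorted_leq_nth le_trans le_refl x0 sorted_s); rewrite ?inE ?sz; lia.
Qed.

(** Both calls of Step 3 run on at most s elements, hence the term 2 B(s). *)
Lemma round_cost_le (x0 : T) X k (S : {set 'I_(size X)})
    (cost : seq T -> nat -> R) (B : nat -> R) :
  x0 \in X -> (1 <= k <= size X)%N -> (0 < ssel alpha (size X))%N ->
  #|S| = ssel alpha (size X) ->
  (forall m, 0 <= B m) -> {homo B : m p / (m <= p)%N >-> m <= p} ->
  (forall (Y : seq T) j, (1 <= j <= size Y)%N -> cost Y j <= B (size Y)) ->
  exists h : nat, [/\ (h < size X)%N,
    round_cost x0 k S cost <=
      (step4_count x0 k S)%:R + 2 * B (ssel alpha (size X)) + B h &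
    step7_size x0 k S h].
Proof.
move=> x0X k1n s0 cS B0 B_homo costB; have [uX vX] := pivots_in k S x0X.
have [h [hn le7 hE]] := step7_cost_le k1n uX vX B0 costB.
exists h; split=> //; rewrite /round_cost; apply: lerD => //.
rewrite -addrA mulr_natl mulr2n; apply: lerD => //.
have uv := iu_iv_sel beta k1n s0; have vs := iv_sel_le beta k1n s0.
have u0 := iu_sel_gt0 alpha beta (size X) k.
have sz : size [seq nth x0 X (val i) | i <- enum S] = ssel alpha (size X).
  by rewrite size_map -cardE cS.
apply: lerD.
  by rewrite -sz; apply: costB; rewrite u0 sz (leq_trans uv).
case: ifP => // ltuv.
apply: (@le_trans _ _ (B (size (drop (iu_sel alpha beta (size X) k) (sample_sort x0 X S))))).
  apply: costB; rewrite size_drop size_sort sz subn_gt0 ltuv leq_sub2r //.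
by apply: B_homo; rewrite size_drop size_sort sz leq_subr.
Qed.

(** Pointwise [F] is at most [G] plus [W] times the indicator of [bad], whose average is at most
    [c]. *)
Lemma average_le (I : finType) (A bad : pred I) (F : I -> R) (G W c N : R) :
  0 <= W -> 0 < N -> #|[set i | A i]|%:R = N ->
  #|[set i | A i && bad i]|%:R <= N * c ->
  (forall i, A i -> F i <= G + W) -> (forall i, A i -> ~~ bad i -> F i <= G) ->
  (\sum_(i | A i) F i) / N <= G + W * c.
Proof.
move=> W0 N0 cA cbad FW FG; rewrite ler_pdivrMr // mulrDl.
apply: (@le_trans _ _ (\sum_(i | A i) (G + W * (bad i)%:R))).
  apply: ler_sum => i Ai; case: (boolP (bad i)) => b; rewrite ?mulr1 ?mulr0 ?addr0.
    exact: FW.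
  exact: FG.
rewrite big_split /= -mulr_sumr; apply: lerD.
  by rewrite sumr_const -cA cardsE mulr_natr.
rewrite -mulrA ler_wpM2l // mulrC (le_trans _ cbad) // -sum1_card natr_sum.
rewrite [leLHS]big_mkcond [leRHS]big_mkcond /=; apply: ler_sum => i _.
by rewrite inE; case: (A i); case: (bad i).
Qed.

End Round.

(** * The recurrence *)

(** Replaces n + min (k, n - k) by 3 n / 2, a bound on recursive calls that depends on the size
    alone. *)
Lemma half_minn_le (R : realFieldType) (j m : nat) :
  (minn j (m - j))%:R <= m%:R / 2 :> R.
Proof. by rewrite ler_pdivlMr // -natrM ler_nat; lia. Qed.

Section Recurrence.
Variables (R : realType) (alpha beta : R).
Hypothesis alpha0 : 0 < alpha.
Variables (disp : Order.disp_t) (T : orderType disp).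
Implicit Types (X : seq T) (n k fuel : nat).

Lemma fsel_gt0 n : (1 < n)%N -> 0 < fsel R n.
Proof.
move=> n1; rewrite mulr_gt0 // powR_gt0 ?ltr0n 1?(ltnW n1) //.
by rewrite ln_gt0 // ltr1n.
Qed.

Lemma ssel_gt0 n : (1 < n)%N -> (0 < ssel alpha n)%N.
Proof.
move=> n1; rewrite leq_min absz_gt0; apply/andP; split; last by case: n n1 => [|[]].
by rewrite gt_eqF // ceil_gt0 mulr_gt0 // fsel_gt0.
Qed.

Lemma ssel_lt n : (0 < n)%N -> (ssel alpha n < n)%N.
Proof. by move=> n0; rewrite -{2}(prednK n0) ltnS geq_minr. Qed.

Lemma card_samples n :
  #|[set S : {set 'I_n} | #|S| == ssel alpha n]| = 'C(n, ssel alpha n).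
Proof. by rewrite card_draws card_ord. Qed.

Lemma samples_gt0 n : (0 < n)%N -> 0 < 'C(n, ssel alpha n)%:R :> R.
Proof. by move=> n0; rewrite ltr0n bin_gt0 ltnW // ssel_lt. Qed.

(** A bound for the finitely many small sizes. Every recursive list is shorter than [X], and 2 n + 3
    (2 4^(n-1)) <= 2 4^n because n <= 4^(n-1). *)
Lemma sel_cost_crude fuel X k : (1 <= k <= size X)%N ->
  sel_cost alpha beta fuel X k <= 2 * 4 ^+ size X.
Proof.
have key (a b c y z w : R) : a <= 2 * z -> b <= 2 * y -> c <= 2 * y -> z <= y ->
    w = 8 * y -> a + 2 * b + c <= w by lra.
elim: fuel X k => [|fuel IH] X k k1n; first by rewrite /= mulr_ge0 ?exprn_ge0.
case: X k1n => [|x0 X']; first by case: k.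
set X := x0 :: X' => k1n; rewrite (@sel_costS _ _ _ _ _ fuel X k x0 X') //.
case: ifP => [_|/negbT n_neq1]; first by rewrite mulr_ge0 ?exprn_ge0.
set n := size X; have n0 : (0 < n)%N by [].
have n1 : (1 < n)%N by rewrite ltn_neqAle eq_sym n_neq1.
rewrite ler_pdivrMr ?samples_gt0 // -card_samples mulr_natr cardsE -sumr_const.
apply: ler_sum => S /eqP cS.
pose B m : R := 2 * 4 ^+ m.
have B0 m : 0 <= B m by rewrite mulr_ge0 ?exprn_ge0.
have B_homo : {homo B : m p / (m <= p)%N >-> m <= p}.
  by move=> m p mp; rewrite ler_pM2l // ler_weXn2l // ler1n.
have [h [hn le_h _]] := round_cost_le beta (mem_head x0 X') k1n (ssel_gt0 n1) cS B0 B_homo IH.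
apply: le_trans le_h _.
have hB : B h <= B n.-1 by apply: B_homo; rewrite -ltnS prednK.
have sB : B (ssel alpha n) <= B n.-1 by apply: B_homo; rewrite -ltnS prednK // ssel_lt.
have c4 : (step4_count alpha beta x0 k S)%:R <= 2 * n%:R :> R.
  by rewrite -natrM ler_nat step4_count_le2.
have n4 : n%:R <= 4 ^+ n.-1 :> R.
  by rewrite -natrX ler_nat -{1}(prednK n0) ltn_expl.
apply: key c4 sB hB n4 _.
by rewrite -{1}(prednK n0) exprS mulrCA mulrA -natrM.
Qed.

(** In any round, Step 4 costs at most 2 n, Step 3 at most 3 s + gamma f / 4, and Step 7 at most
    B(n). With good pivots, Step 4 exceeds n + min (k, n - k) by at most 2 q + 1, and Step 7 has
    size h <= 4 q + 2, costing at most 6 q + 3 + gamma f / 8. *)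
Lemma good_round_le gamma X x0 k (S : {set 'I_(size X)}) cost :
  let n := size X in let s := ssel alpha n in
  let q := gsel alpha beta n * n%:R / s%:R in
  0 <= gamma -> x0 \in X -> (1 <= k <= n)%N -> (0 < s)%N -> #|S| = s ->
  s%:R <= n%:R / 64 :> R -> 4 * q + 2 <= n%:R / 64 ->
  (forall (Y : seq T) j, (1 <= j <= size Y)%N ->
     cost Y j <= 3 / 2 * (size Y)%:R + gamma * fsel R (size Y)) ->
  (round_cost alpha beta x0 k S cost
     <= 2 * n%:R + 3 * s%:R + 3 / 2 * n%:R + 5 / 4 * (gamma * fsel R n)) /\
  (good_pivots alpha beta x0 X k S ->
     round_cost alpha beta x0 k S cost
       <= n%:R + (minn k (n - k))%:R + 8 * q + 4 + 3 * s%:R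
          + 3 / 8 * (gamma * fsel R n)).
Proof.
move=> n s q gamma0 x0X k1n s0 cS s_small q_small costB.
pose B m : R := 3 / 2 * m%:R + gamma * fsel R m.
have c0 : 0 < 3 / 2 :> R by lra.
have B0 m : 0 <= B m by rewrite addr_ge0 // mulr_ge0 // ?fsel_ge0 // ltW.
have B_homo : {homo B : m p / (m <= p)%N >-> m <= p}.
  move=> m p mp; apply: lerD; first by rewrite (ler_pM2l c0) ler_nat.
  by rewrite ler_wpM2l // fsel_le.
have [h [hn le_h hE]] := round_cost_le beta x0X k1n s0 cS B0 B_homo costB.
have sB : B s <= 3 / 2 * s%:R + gamma * (fsel R n / 8).
  by rewrite lerD2l ler_wpM2l // fsel_le_eighth.
have gf : gamma * (fsel R n / 8) = gamma * fsel R n / 8 by ring.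
rewrite gf in sB.
split.
  have hB : B h <= 3 / 2 * n%:R + gamma * fsel R n by apply: (B_homo h n); exact: ltnW.
  have c4 : (step4_count alpha beta x0 k S)%:R <= 2 * n%:R :> R.
    by rewrite -natrM ler_nat step4_count_le2.
  by move: le_h; rewrite -/n -/s; lra.
case; rewrite -/n -/s -/q => good_v good_u good_L good_R.
have kn : (k <= n)%N by case/andP: k1n.
have knR : (n - k)%:R = n%:R - k%:R :> R by rewrite natrB.
have q0 : 0 <= q by rewrite divr_ge0 ?mulr_ge0 ?sqrtr_ge0.
have c4 : (step4_count alpha beta x0 k S)%:R <= n%:R + (minn k (n - k))%:R + 2 * q + 1.
  apply: (@le_trans _ _ (n + (if (2 * k < n)%N
    then count (fun x => x < pivot_v alpha beta x0 X k S)%O X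
    else count (fun x => pivot_u alpha beta x0 X k S < x)%O X))%:R).
    by rewrite ler_nat step4_count_le.
  rewrite natrD; case: ifP => k2n.
    have /minn_idPl-> : (k <= n - k)%N by rewrite leq_subRL // addnn -mul2n ltnW.
    by move: good_v; lra.
  have /minn_idPr-> : (n - k <= k)%N by rewrite leq_subLR addnn -mul2n leqNgt k2n.
  by rewrite knR; move: good_u; lra.
have uv := pivots_le beta x0 k1n s0 cS.
have h_small : h%:R <= 4 * q + 2.
  (* L lies in {x < v} and is chosen only if k <= q, so |L| <= 3 q + 1; R is symmetric. For M, the
     two counts add up to at most n + 4 q + 2. *)
  case: hE => [->|[kL ->]|[kR ->]|hM].
  - by rewrite mulr0n; lra.
  - have kq : k%:R <= q by rewrite leNgt; apply/negP => /good_L; rewrite ltnNge kL.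
    apply: (@le_trans _ _ (count (fun x => x < pivot_v alpha beta x0 X k S)%O X)%:R).
      by rewrite ler_nat sub_count // => x /= /lt_le_trans; apply.
    lra.
  - have kq : n%:R - k%:R <= q.
      rewrite leNgt; apply/negP => lt_q.
      suff : k%:R + q <= n%:R by move/good_R; rewrite leqNgt kR.
      lra.
    apply: (@le_trans _ _ (count (fun x => pivot_u alpha beta x0 X k S < x)%O X)%:R).
      by rewrite ler_nat sub_count // => x /=; exact: le_lt_trans.
    lra.
  - have : h%:R + n%:R = (count (fun x => x < pivot_v alpha beta x0 X k S)%O X)%:R
      + (count (fun x => pivot_u alpha beta x0 X k S < x)%O X)%:R :> R.
      by rewrite -!natrD hM.
    lra.
have hB : B h <= 3 / 2 * (4 * q + 2) + gamma * (fsel R n / 8).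
  apply: lerD; first by rewrite (ler_pM2l c0).
  by rewrite ler_wpM2l // fsel_le_eighth // (le_trans h_small).
rewrite gf in hB.
by move: le_h; rewrite -/n -/s; lra.
Qed.

End Recurrence.

Theorem theorem4p1 (R : realType) (alpha beta : R) :
  0 < alpha -> 1 / 6 <= beta ->
  exists gamma : R, 0 < gamma /\
    forall (d : Order.disp_t) (T : orderType d) (n k : nat) (X : seq T),
      (1 <= n)%N -> (1 <= k <= n)%N -> size X = n ->
      select_cost alpha beta X k
        <= n%:R + (minn k (n - k))%:R + gamma * fsel R n.
Proof.
move=> alpha0 beta6; have [N [K [K0 large]]] := large_n_params alpha0 beta6.
have f2 : 0 < fsel R 2 by exact: fsel_gt0.
(* The first term absorbs (11 K + 18) f into gamma f / 3; the second makes gamma f(2) dominate the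
   crude bound for 2 <= n < N. At n = 1, where f vanishes, the cost is 0. *)
pose gamma := 3 * (11 * K + 18) + 2 * 4 ^+ N / fsel R 2.
have crude0 : 0 <= 2 * 4 ^+ N / fsel R 2 :> R.
  by apply: divr_ge0; [rewrite mulr_ge0 ?exprn_ge0 | exact: ltW].
exists gamma; split=> [|d T n k X _ k1n sX]; first by rewrite /gamma; lra.
have gamma0 : 0 <= gamma by rewrite /gamma; lra.
(* The fuel is detached from the size of [X]: running out of it costs 0, so the bound holds for any
   fuel. *)
rewrite /select_cost -sX in k1n *; move: (size X) {-2}X k k1n => fuel.
clear n X sX; elim: fuel => [|fuel IH] X k k1n.
  by rewrite /= !addr_ge0 // mulr_ge0 // fsel_ge0.
case: X k1n => [|x0 X']; first by case: k.
set X := x0 :: X' => k1n; set n := size X.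
have [n_lt|n_ge] := ltnP n N.
  have [n1|n1] := leqP n 1.
    rewrite (@sel_costS _ _ _ _ _ fuel X k x0 X') // (_ : size X == 1%N).
      by rewrite !addr_ge0 // mulr_ge0 // fsel_ge0.
    by rewrite eqn_leq n1.
  apply: le_trans (sel_cost_crude _ alpha0 _ k1n) _.
  apply: (@le_trans _ _ (gamma * fsel R 2)).
    apply: (@le_trans _ _ (2 * 4 ^+ N / fsel R 2 * fsel R 2)).
      rewrite divfK ?lt0r_neq0 // ler_pM2l // ler_weXn2l ?ler1n //; exact: ltnW.
    by rewrite ler_wpM2r ?fsel_ge0 // /gamma; lra.
  apply: le_trans (_ : gamma * fsel R n <= _).
    by rewrite ler_wpM2l // fsel_le.
  by rewrite lerDr addr_ge0.
have [[n1 s0] [f1 sK] [qK s_small] q_small [pf p16]] := large n n_ge.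
rewrite (@sel_costS _ _ _ _ _ fuel X k x0 X') // ifN ?gtn_eqF //.
have costB (Y : seq T) j : (1 <= j <= size Y)%N ->
    sel_cost alpha beta fuel Y j <= 3 / 2 * (size Y)%:R + gamma * fsel R (size Y).
  move=> j_ok; apply: le_trans (IH _ _ j_ok) _; rewrite lerD2r.
  by have := half_minn_le R j (size Y); lra.
have [bad r_bad good] := good_pivots_likely beta6 x0 (erefl (size X)) k1n s0.
have round := fun S cS =>
  @good_round_le R alpha beta d T gamma X x0 k S _ gamma0 (mem_head x0 X') k1n s0 cS
    s_small q_small costB.
set s := ssel alpha n in round sK qK s_small q_small r_bad *.
set q := gsel alpha beta n * n%:R / s%:R in round qK q_small.
(* [W] covers the gap between the two bounds of [good_round_le]. *)
pose W : R := 7 / 2 * n%:R + gamma * fsel R n.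
have f0 := fsel_ge0 R n.
have gf0 : 0 <= gamma * fsel R n by rewrite mulr_ge0.
have q0 : 0 <= q by rewrite divr_ge0 ?mulr_ge0 ?sqrtr_ge0.
have n0 : 0 <= n%:R :> R by [].
have m0 : 0 <= (minn k (n - k))%:R :> R by [].
have W0 : 0 <= W by rewrite /W; lra.
have C0 : 0 < 'C(n, s)%:R :> R by exact: samples_gt0.
apply: (le_trans (@average_le R _ (fun S : {set 'I_n} => #|S| == s) bad
  (fun S => round_cost alpha beta x0 k S (sel_cost alpha beta fuel))
  (n%:R + (minn k (n - k))%:R + 8 * q + 4 + 3 * s%:R + 3 / 8 * (gamma * fsel R n))
  W (4 * fail_prob R n) 'C(n, s)%:R W0 C0 _ r_bad _ _)).
- by rewrite card_samples.
- by move=> S /eqP cS; have [le_S _] := round S cS; rewrite /W; lra.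
- by move=> S /eqP cS nbad; have [_] := round S cS; apply; exact: good.
(* Here 8 q + 4 + 3 s + 14 n^(2/3) <= (11 K + 18) f. The coefficients of gamma f add up to 3/8 +
   4/16 + 1/3 < 1. *)
have gammaK : (11 * K + 18) * fsel R n <= gamma / 3 * fsel R n.
  by rewrite ler_wpM2r // /gamma; lra.
have pgf : fail_prob R n * (gamma * fsel R n) <= 1 / 16 * (gamma * fsel R n).
  by rewrite ler_wpM2r.
have -> : W * (4 * fail_prob R n) = 14 * (fail_prob R n * n%:R)
    + 4 * (fail_prob R n * (gamma * fsel R n)) by rewrite /W; field.
have : gamma / 3 * fsel R n = (gamma * fsel R n) / 3 by ring.
lra.
Qed.
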